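(* Let $n\ge 1$ and let $O_1,\dots,O_{2\lceil n/2\rceil-1}$ be a family of (not necessarily distinct) odd cycles in the complete graph $K_n$. Then the family has a rainbow odd cycle.
   Context: A cycle is regarded as its set of edges. A family means a multiset (repetitions allowed). Given a family $\mathcal{E}$ of edge sets, an $\mathcal{E}$-rainbow set is a set $R\subseteq\bigcup\mathcal{E}$ together with an injection $\sigma:R\to\mathcal{E}$ such that $e\in\sigma(e)$ for all $e\in R$ (i.e., the edges of $R$ come from distinct members of the family). A rainbow odd cycle is a rainbow set of edges forming a cycle of odd length. *)

(* Defs.v *)
From mathcomp Require Import all_boot.

Set Implicit Arguments.
Unset Strict Implicit.
Unset Printing Implicit Defensive.

(* Edges are unordered pairs [set x; y] of adjacent vertices; the bound
   [2 < size s] excludes the degenerate closed walks x, y, x. *)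
Definition cycle_edges (T : finType) (s : seq T) : {set {set T}} :=
  [set [set x; next s x] | x in s].

Definition is_cycle (T : finType) (e : rel T) (C : {set {set T}}) : Prop :=
  exists s : seq T, [/\ ucycle e s, 2 < size s & C = cycle_edges s].

Definition is_odd_cycle (T : finType) (e : rel T) (C : {set {set T}}) : Prop :=
  is_cycle e C /\ odd #|C|.

Definition complete_graph (n : nat) : rel 'I_n := [rel x y | x != y].

(* A multiset of edge sets is an indexed family F : I -> _; members are
   distinguished by their index, so repetitions are allowed. *)
Definition rainbow (T I : finType) (F : I -> {set {set T}})
    (R : {set {set T}}) : Prop :=
  R \subset \bigcup_i F i /\
  exists sigma : {e : {set T} | e \in R} -> I,
    injective sigma /\ forall e, val e \in F (sigma e).

(* Main.v *)
(* Edges are vectors over F_2 (their incidence vectors, with one vertex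
   dropped), and the members of the family are sets S_i of odd size with
   zero sum. Suppose that no odd rainbow set has zero sum. A rainbow basis
   (x_i), with x_i in S_i, is then obtained greedily, because an S_i inside
   the span of the others would consist of oddly many sums of oddly many
   x_k. Write c(w) for the set of basis coordinates of w and let P i j be
   the parity of the number of w in S_i with i, j in c(w). Every w in S_i
   with #|c(w)| even has i in c(w), and there are oddly many such w, so for
   fixed i the sum of P i j over j != i is odd. Exchanging two basis
   elements shows that P is symmetric. Hence the number of members is even.
   Since 2 * uphalf n - 1 is odd and at least n - 1, an odd rainbow set with
   zero sum exists; it is not bipartite, so it contains an odd cycle. *)
Require Import Defs.
From mathcomp Require Import all_boot.

Set Implicit Arguments.
Unset Strict Implicit.
Unset Printing Implicit Defensive.

(** * Sums over F_2, written as parities *)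

Local Notation "\xor_ ( i 'in' A ) F" := (\big[addb/false]_(i in A) F)
  (at level 41, F at level 41, i, A at level 50).
Local Notation "\xor_ ( i | P ) F" := (\big[addb/false]_(i | P) F)
  (at level 41, F at level 41, i at level 50).
Local Notation "\xor_ i F" := (\big[addb/false]_i F)
  (at level 41, F at level 41, i at level 0).

Lemma xor_true (I : finType) (A : {pred I}) : \xor_(i in A) true = odd #|A|.
Proof.
by rewrite -sum1_card (big_morph odd oddD (erefl : odd 0 = false)).
Qed.

Lemma xor_mem (I : finType) (A : {set I}) (F : I -> bool) :
  \xor_(i in A) F i = \xor_i ((i \in A) && F i).
Proof. by rewrite big_mkcond; apply: eq_bigr => i _; case: (i \in A). Qed.

Lemma xor_ex (I : finType) (A : {pred I}) (F : I -> bool) :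
  \xor_(i in A) F i -> exists2 i, i \in A & F i.
Proof.
move=> h; suff /existsP[i /andP[]] : [exists i, (i \in A) && F i] by exists i.
apply: contraLR h => /existsPn h; rewrite big1 // => i Ai.
by apply/negbTE; move: (h i); rewrite Ai.
Qed.

Definition symdiff (I : finType) (A B : {set I}) :=
  [set i | (i \in A) (+) (i \in B)].

Lemma xor_symdiff (I : finType) (A B : {set I}) (F : I -> bool) :
  \xor_(i in symdiff A B) F i = (\xor_(i in A) F i) (+) (\xor_(i in B) F i).
Proof.
rewrite !xor_mem -big_split; apply: eq_bigr => i _.
by rewrite inE andb_addl.
Qed.

Lemma odd_symdiff (I : finType) (A B : {set I}) :
  odd #|symdiff A B| = odd #|A| (+) odd #|B|.
Proof. by rewrite -!xor_true xor_symdiff. Qed.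

(** On the left [k] is counted once for each [A e] containing it, so only the parity of that number
    matters. A sum of combinations becomes one combination, to which freeness applies. *)
Lemma xor_xor (I E : finType) (Q : {set E}) (A : E -> {set I}) (F : I -> bool) :
  \xor_(e in Q) \xor_(k in A e) F k =
  \xor_(k in [set k | \xor_(e in Q) (k \in A e)]) F k.
Proof.
under eq_bigr do rewrite xor_mem.
rewrite exchange_big xor_mem /=; apply: eq_bigr => k _.
by rewrite inE big_distrl.
Qed.

(** Each unordered pair contributes two equal terms, which cancel; enumeration ranks split the sum
    into the two sides of the diagonal. *)
Lemma xor_offdiag (I : finType) (P : I -> I -> bool) :
  (forall i j, i != j -> P i j -> P j i) ->
  \xor_i \xor_(j | j != i) P i j = false.
Proof.
move=> symP; have {}symP i j : i != j -> P i j = P j i.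
  by move=> ij; apply/idP/idP; apply: symP; rewrite // eq_sym.
pose lt (i j : I) := enum_rank i < enum_rank j.
have neqE (i j : I) : (j != i) = (lt j i || lt i j).
  by rewrite -neq_ltn (inj_eq val_inj) (inj_eq enum_rank_inj).
rewrite (eq_bigr (fun i =>
  (\xor_(j | lt j i) P i j) (+) (\xor_(j | lt i j) P i j))).
  rewrite big_split /= [X in _ (+) X](exchange_big_dep xpredT) //=.
  rewrite -big_split big1 //= => i _; rewrite -big_split big1 //= => j ltji.
  by rewrite symP ?addbb // neqE ltji orbT.
move=> i _; rewrite (bigID (lt^~ i)) /=; congr (_ (+) _).
  by apply: eq_bigl => j; rewrite neqE; case: (lt j i); rewrite ?andbF.
by apply: eq_bigl => j; rewrite neqE /lt -leqNgt; case: ltngtP.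
Qed.

(** * Families of odd zero-sum sets of vectors over F_2 *)

Section OddRelations.

Variables (I D E : finType) (v : E -> D -> bool) (S : I -> {set E}).

Hypothesis leDI : #|D| <= #|I|.
Hypothesis oddS : forall i, odd #|S i|.
Hypothesis xorS : forall i d, \xor_(e in S i) v e d = false.
Hypothesis noR : forall (J : {set I}) (g : I -> E),
  {in J, forall j, g j \in S j} ->
  (forall d, \xor_(j in J) v (g j) d = false) -> ~~ odd #|J|.

(* Subset sums are all the linear combinations over F_2. *)
Definition free_on (g : I -> E) (K : {set I}) :=
  forall A : {set I}, A \subset K ->
    (forall d, \xor_(i in A) v (g i) d = false) -> A = set0.

(** By disjointness, [h] on [J] and [g] on [B] together choose one vector per member. The total is
    zero, so [noR] makes the size of the union even. *)
Lemma mixed_relation_even (K J B : {set I}) (g h : I -> E) :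
  {in K, forall k, g k \in S k} -> B \subset K ->
  {in J, forall j, h j \in S j} -> [disjoint J & B] ->
  (forall d, \xor_(j in J) v (h j) d = \xor_(k in B) v (g k) d) ->
  odd #|J| = odd #|B|.
Proof.
move=> gS sBK hS dJB eqd; apply/eqP; rewrite -negb_add -odd_symdiff.
have nJ k : k \in B -> k \in J = false by move=> /(disjointFl dJB).
apply: (@noR _ (fun k => if k \in J then h k else g k)).
  move=> k; rewrite inE; case: ifP => [kJ _|_ /= kB]; first exact: hS.
  by apply: gS; apply: (subsetP sBK).
move=> d; rewrite xor_symdiff.
rewrite (eq_bigr (fun j => v (h j) d)); last by move=> j ->.
rewrite [X in _ (+) X](eq_bigr (fun k => v (g k) d)); last by move=> k /nJ ->.
by rewrite eqd addbb.
Qed.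

Lemma rainbow_free_on (K : {set I}) :
  exists2 g : I -> E, {in K, forall i, g i \in S i} & free_on g K.
Proof.
have exS i : exists e, e \in S i.
  by apply/set0Pn; apply: contraTneq (oddS i) => ->; rewrite cards0.
move: {2}#|K| (erefl #|K|) => m; elim: m K => [|m IH] K cK.
  exists (fun i => xchoose (exS i)) => [i _|A]; first exact: xchooseP.
  by rewrite (cards0_eq cK) subset0 => /eqP.
have [i iK] : exists i, i \in K by apply/set0Pn; rewrite -card_gt0 cK.
have [|g gS fg] := IH (K :\ i).
  by apply/eqP; rewrite -eqSS -cK (cardsD1 i K) iK.
pose spans e (A : {set I}) :=
  (A \subset K :\ i) && [forall d, v e d == \xor_(k in A) v (g k) d].
(* Either some [e] in [S i] escapes the span and extends [g], or all of [S i] is spanned, which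
   parity rules out. *)
have [sp|] := boolP [forall e in S i, [exists A, spans e A]]; last first.
  case/forall_inPn => e eS /existsPn nsp.
  exists (fun k => if k == i then e else g k) => [k kK|A sAK hA].
    case: eqP => [->//|/eqP ki]; apply: gS; first by rewrite !inE ki.
  have eqA (B : {set I}) d : B \subset ~: [set i] ->
      \xor_(k in B) v (if k == i then e else g k) d = \xor_(k in B) v (g k) d.
    move=> /subsetP sB; apply: eq_bigr => k /sB.
    by rewrite !inE => /negbTE ->.
  have [iA|niA] := boolP (i \in A); last first.
    apply: fg => [|d].
      by rewrite subsetD1 sAK.
    by rewrite -[RHS](hA d) eqA // subsetC sub1set inE.
  case/negP: (nsp (A :\ i)); rewrite /spans setSD //=.
  apply/forallP => d; move: (hA d); rewrite (big_setD1 i) //= eqxx.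
  rewrite eqA; last by apply/subsetP => k; rewrite !inE => /andP[].
  by case: (v e d); case: (\xor_(_ in _) _).
pose c e := odflt set0 [pick A | spans e A].
have cP e : e \in S i -> spans e (c e).
  move=> eS; rewrite /c; case: pickP => //= n.
  by have /existsP[A] := forall_inP sp _ eS; rewrite n.
(* Member [i], represented by [e], has the same sum as the combination [c e], so 1 and [#|c e|]
   agree in parity. *)
have codd e : e \in S i -> odd #|c e|.
  move=> eS; have /andP[sc /forallP hc] := cP _ eS.
  rewrite -(mixed_relation_even (J := [set i]) (h := fun=> e) gS sc) ?cards1 //.
  - by move=> j /set1P ->.
  - rewrite disjoints1; apply: contraTN sc => ic.
    by apply/subsetPn; exists i; rewrite ?inE ?eqxx.
  - by move=> d; rewrite big_set1; apply/eqP.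
have cS : \xor_(e in S i) odd #|c e|.
  by rewrite (eq_bigr (fun=> true)) ?xor_true.
(* As [S i] sums to zero, freeness makes the combinations cancel, so their sizes have an even total,
   against [cS]. *)
move: cS; under eq_bigr do rewrite -xor_true.
rewrite xor_xor (_ : [set _ | _] = set0) ?big_set0 //; apply: fg.
  apply/subsetP => k; rewrite inE => /xor_ex[e eS kc].
  by have /andP[/subsetP sc _] := cP _ eS; apply: sc.
move=> d; rewrite -xor_xor -[RHS](xorS i d); apply: eq_bigr => e eS.
by have /andP[_ /forallP/(_ d)/eqP ->] := cP _ eS.
Qed.

Lemma no_odd_relation_even : ~~ odd #|I|.
Proof.
have [g gS fg] := rainbow_free_on setT.
pose comb (A : {set I}) := [ffun d => \xor_(k in A) v (g k) d].
have comb_inj : injective comb.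
  move=> A B /ffunP eqAB; apply/setP => k; apply/eqP; rewrite -negb_add.
  suff /setP/(_ k) : symdiff A B = set0 by rewrite !inE => ->.
  apply: fg => [|d]; first exact: subsetT.
  by rewrite xor_symdiff; move: (eqAB d); rewrite !ffunE => ->; rewrite addbb.
(* By [leDI] the injection [comb] is onto, so [g] is a basis. *)
have cardle : #|{: {ffun D -> bool}}| <= #|{: {set I}}|.
  rewrite card_ffun card_bool -[leqRHS]cardsT -powersetT card_powerset cardsT.
  by rewrite leq_exp2l.
have span e : exists A, comb A == finfun (v e).
  have /codomP[A ->] := inj_card_onto comb_inj cardle (finfun (v e)).
  by exists A.
pose c e := xchoose (span e).
have cE e d : v e d = \xor_(k in c e) v (g k) d.
  by have /eqP/ffunP/(_ d) := xchooseP (span e); rewrite !ffunE.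
have xorc i k : \xor_(e in S i) (k \in c e) = false.
  suff /setP/(_ k) : [set k | \xor_(e in S i) (k \in c e)] = set0.
    by rewrite !inE.
  apply: fg => [|d]; first exact: subsetT.
  by rewrite -xor_xor -[RHS](xorS i d); apply: eq_bigr => e _; rewrite cE.
have xor_oddc i : \xor_(e in S i) odd #|c e| = false.
  under eq_bigr do rewrite -xor_true.
  by rewrite xor_xor big1 // => k; rewrite inE xorc.
(* Otherwise [e], chosen for member [i], and the basis vectors of [c e] would form an odd zero-sum
   choice. *)
have bad i e : e \in S i -> ~~ odd #|c e| -> i \in c e.
  move=> eS; apply: contraR => ic.
  rewrite -(mixed_relation_even (J := [set i])
    (h := fun=> e) gS (subsetT (c e))) ?cards1 //.
  - by move=> j /set1P ->.
  - by rewrite disjoints1.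
  - by move=> d; rewrite big_set1.
(* Exchange: [e] and [f] replace the basis vectors of [i] and [j]. Equal coordinates there keep the
   symmetric difference of [c e] and [c f] away from both indices. *)
have pair i j e f : i != j -> e \in S i -> f \in S j ->
    (i \in c e) = (i \in c f) -> (j \in c e) = (j \in c f) ->
    odd #|c e| = odd #|c f|.
  move=> ij eS fS ei ej; apply/eqP; rewrite -negb_add -odd_symdiff.
  rewrite -(mixed_relation_even (J := [set i; j])
    (h := fun k => if k == i then e else f) gS (subsetT _)) ?cards2 ?ij //.
  - move=> k; rewrite !inE; case: eqP => [->//|_ /= /eqP ->//].
  - rewrite -setI_eq0; apply/eqP/setP => k; rewrite !inE.
    have [->|_] := eqVneq k i; first by rewrite ei addbb.
    by have [->|_] := eqVneq k j; first by rewrite ej addbb.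
  - move=> d; rewrite big_setU1 ?inE //= big_set1 eqxx eq_sym (negbTE ij).
    by rewrite xor_symdiff !cE.
have nbad i : \xor_(e in S i) ~~ odd #|c e|.
  under eq_bigr do rewrite -addTb.
  by rewrite big_split /= xor_oddc xor_true oddS.
pose P i j := \xor_(e in S i) ((i \in c e) && (j \in c e)).
(* Each [e] contributes the parity of [c e] without [i] if [i \in c e], and 0 otherwise; by [bad]
   this is 1 exactly when [#|c e|] is even. *)
have rowP i : \xor_(j | j != i) P i j = true.
  rewrite exchange_big /= -[RHS](nbad i); apply: eq_bigr => e eS.
  rewrite -big_distrr /= -xor_true.
  rewrite (xor_mem (c e)) [X in ~~ X](bigD1 i) //= andbT.
  under [X in ~~ (_ (+) X)]eq_bigr do rewrite andbT.
  have := bad _ _ eS.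
  rewrite -xor_true (xor_mem (c e)) [X in ~~ X](bigD1 i) //= andbT.
  under [X in ~~ (_ (+) X)]eq_bigr do rewrite andbT.
  by case: (i \in c e); case: (\xor_(_ | _) _) => //= /(_ isT).
have symP i j : i != j -> P i j -> P j i.
  move=> ij Pij.
  (* Evenly many vectors of [S i] have coordinate [j]; oddly many of them have [i] too, so oddly
     many lack it. *)
  have [w0 w0S /andP[iw0 jw0]] :
      exists2 e, e \in S i & (i \notin c e) && (j \in c e).
    apply: xor_ex.
    suff -> : \xor_(e in S i) ((i \notin c e) && (j \in c e)) = P i j by [].
    transitivity (P i j (+) \xor_(e in S i) (j \in c e)).
      2: by rewrite xorc addbF.
    rewrite -big_split /=.
    by apply: eq_bigr => e _; case: (i \in c e); case: (j \in c e).
  have ow0 : odd #|c w0| by apply: contraR iw0; apply: bad.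
  have badj f : f \in S j -> ~~ odd #|c f| -> (j \in c f) && (i \in c f).
    move=> fS ef; have jf := bad _ _ fS ef; rewrite jf /=.
    apply: contraR ef => nif.
    by rewrite -(pair i j w0 f ij w0S fS) ?jw0 ?jf ?(negbTE iw0) ?(negbTE nif).
  (* Comparison with [w1] makes [w2] even; comparison with [w2] then shows that the vectors of [S j]
     with both coordinates are exactly the even ones. *)
  have [w1 w1S ew1] := xor_ex (nbad j).
  have /andP[jw1 iw1] := badj _ w1S ew1.
  have [w2 w2S /andP[iw2 jw2]] := xor_ex Pij.
  have ew2 : ~~ odd #|c w2|.
    by rewrite (pair i j w2 w1 ij w2S w1S) ?iw2 ?jw2 ?iw1 ?jw1.
  rewrite /P /is_true -[RHS](nbad j); apply: eq_bigr => f fS.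
  apply/idP/idP => [/andP[jf if_]|]; last exact: badj.
  by rewrite -(pair i j w2 f ij w2S fS) ?iw2 ?jw2 ?jf ?if_.
(* Every row is odd, so the off-diagonal total has the parity of [#|I|]; by symmetry it is zero. *)
have := xor_offdiag symP; under eq_bigr do rewrite rowP.
by rewrite xor_true => ->.
Qed.

End OddRelations.

(** * Odd closed walks and bipartite graphs *)

(** A repeated vertex cuts a closed walk into two shorter ones, and an odd total length leaves one
    of them odd. *)
Lemma odd_cycle_ucycle (T : eqType) (e : rel T) (s : seq T) :
  cycle e s -> odd (size s) -> exists2 c, ucycle e c & odd (size c).
Proof.
have [m] := ubnP (size s); elim: m s => // m IH s ltsm cs os.
have [us|/uniqPn] := boolP (uniq s); first by exists s => //; apply/andP.
have [x0 _] : exists x, x \in s.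
  by case: s os {IH ltsm cs} => // x s _; exists x; rewrite mem_head.
move=> /(_ x0)[i [j [ltij ltjs eqij]]].
have ltis := ltn_trans ltij ltjs.
set x := nth x0 s i in eqij.
have srot : rot i s = x :: (take (j - i.+1) (drop i.+1 s)
    ++ x :: (drop j.+1 s ++ take i s)).
  rewrite /rot (drop_nth x0) // -/x.
  rewrite -[in LHS](cat_take_drop (j - i.+1) (drop i.+1 s)).
  rewrite drop_drop subnK // (drop_nth x0 ltjs) -eqij.
  by rewrite /= -catA.
set p := take _ _ in srot; set q := _ ++ take i s in srot.
have csz : size s = (size p).+1 + (size q).+1.
  by rewrite -(size_rot i) srot /= size_cat /= addSn.
have := cs; rewrite -(rot_cycle i) srot /= rcons_cat cat_path /=.
case/and3P=> ep lp eq.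
rewrite csz ltnS in ltsm.
have [op|ep'] := boolP (odd (size p).+1).
  apply: (IH (x :: p)) => //=; last by rewrite rcons_path ep.
  by apply: leq_trans ltsm; rewrite addnS ltnS leq_addr.
apply: (IH (x :: q)) => //=.
  by apply: leq_trans ltsm; rewrite addSn ltnS leq_addl.
by move: os; rewrite csz oddD (negbTE ep').
Qed.

Lemma odd_cycle_or_bipartite (T : finType) (e : rel T) : symmetric e ->
  (exists2 s, cycle e s & odd (size s)) \/
  exists f : T -> bool, forall x y, e x y -> f x != f y.
Proof.
move=> syme.
(* The bipartite double cover: odd closed walks join its two layers. *)
pose e2 : rel (T * bool) := [rel a b | e a.1 b.1 && (a.2 != b.2)].
have e2P x b p : path e2 (x, b) p ->
    path e x (map fst p) /\ (last (x, b) p).2 = b (+) odd (size p).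
  elim: p x b => [|[y c] p IH] x b /=; first by rewrite addbF.
  move=> /andP[/andP[exy bc] /IH[-> ->]]; rewrite /= in exy bc *.
  rewrite exy; split=> //.
  by case: b bc; case: c {exy}; case: odd.
have conn_sym2 : connect_sym e2.
  by apply: sym_connect_sym => a b; rewrite /e2 /= syme eq_sym.
have [/existsP[x /connectP[p /e2P[pp lp] eqp]]|/existsPn noconn] :=
    boolP [exists x, connect e2 (x, true) (x, false)]; [left|right].
  rewrite -eqp /= in lp.
  have lx : last x (map fst p) = x.
    by rewrite -[x in LHS]/((x, true).1) last_map -eqp.
  have op : odd (size p) by case: (odd _) lp.
  case/lastP: p pp lx op {lp eqp} => [//|p [y c]].
  rewrite map_rcons last_rcons size_rcons /= => pp eqyx op; rewrite eqyx in pp.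
  by exists (x :: map fst p) => //=; rewrite size_map.
have conn_sym : connect_sym e by apply: sym_connect_sym.
pose rt := fingraph.root e.
have conn_rt x : exists b, connect e2 (rt x, true) (x, b).
  have : connect e (rt x) x by rewrite conn_sym connect_root.
  move: (rt x) => z; case/connectP => p pp ->.
  elim/last_ind: p pp => [|p y IH] /=; first by exists true; apply: connect0.
  rewrite rcons_path last_rcons => /andP[/IH[b cb] ey]; exists (~~ b).
  by apply: connect_trans cb (connect1 _); rewrite /e2 /= ey; case: b.
(* The colour records the layer in which [x] is reached from its root: some layer by [conn_rt], only
   one by [noconn]. *)
exists (fun x => connect e2 (rt x, true) (x, true)) => x y exy.
have eqr : rt x = rt y by apply/eqP; rewrite root_connect // connect1.
have step b :
    connect e2 (rt y, true) (x, b) -> connect e2 (rt y, true) (y, ~~ b).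
  move=> cb; apply: connect_trans cb (connect1 _).
  by rewrite /e2 /= exy; case: b.
have nb z : connect e2 (rt y, true) (z, true) ->
    connect e2 (rt y, true) (z, false) -> false.
  rewrite conn_sym2 => c1 c2.
  by move: (noconn z); rewrite (connect_trans c1 c2).
rewrite eqr; case: (boolP (connect _ _ (x, true))) => cx.
  by rewrite eq_sym eqb_id; apply/negP => cy; have := nb _ cy (step _ cx).
have [[|] cb] := conn_rt x; rewrite eqr in cb; first by rewrite cb in cx.
by rewrite (step _ cb).
Qed.

(** * Edge sets of cycles *)

Lemma next_next_neq (T : eqType) (s : seq T) x :
  uniq s -> 2 < size s -> x \in s -> next s (next s x) != x.
Proof.
move=> us szs xs; have [i s' def_s] := rot_to xs.
rewrite -!(next_rot i us) def_s.
have := us; rewrite -(rot_uniq i) def_s.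
move: szs; rewrite -(size_rot i) def_s.
case: s' {def_s} => [|y [|z s']] //= _ /and3P[].
rewrite !inE !negb_or eqxx => /and3P[xy xz _] _ _.
by rewrite (eq_sym y) (negbTE xy) eqxx eq_sym.
Qed.

Lemma next_neq (T : eqType) (s : seq T) x :
  uniq s -> 2 < size s -> x \in s -> next s x != x.
Proof.
move=> us szs xs; apply: contraNneq (next_next_neq us szs xs) => nx.
by rewrite !nx.
Qed.

(** Equal edges at distinct [x] and [y] would make each the successor of the other, closing the
    cycle after two steps. *)
Lemma cycle_edge_inj (T : finType) (s : seq T) : uniq s -> 2 < size s ->
  {in s &, injective (fun x => [set x; next s x])}.
Proof.
move=> us szs x y xs ys /= /setP eqxy; apply/eqP/negPn/negP => nxy.
have := eqxy x; rewrite !inE eqxx (negbTE nxy) /= => /esym/eqP xny.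
have := eqxy y; rewrite !inE eqxx eq_sym (negbTE nxy) /= => /eqP ynx.
by move: (next_next_neq us szs xs); rewrite -ynx -xny eqxx.
Qed.

Lemma card_cycle_edges (T : finType) (s : seq T) : uniq s -> 2 < size s ->
  #|cycle_edges s| = size s.
Proof.
move=> us szs; rewrite card_in_imset ?(card_uniqP us) //.
exact: cycle_edge_inj.
Qed.

(** The edge starting at [y] counts [x == y] and [x == next s y]; as [next s] permutes [s], the two
    sums agree and cancel. *)
Lemma cycle_edges_degree (T : finType) (s : seq T) x : uniq s -> 2 < size s ->
  \xor_(e in cycle_edges s) (x \in e) = false.
Proof.
move=> us szs; rewrite big_imset /=; last exact: cycle_edge_inj.
rewrite (eq_bigr (fun y => (x == y) (+) (x == next s y))); last first.
  move=> y ys; rewrite !inE; have := next_neq us szs ys.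
  by have [->|//] := eqVneq x y; rewrite eq_sym => /negbTE ->.
rewrite big_split /= [X in _ (+) X](reindex_onto (prev s) (next s)) /=.
  2: by move=> y _; apply: prev_next.
rewrite [X in _ (+) X](eq_big (mem s) (eq_op x)) ?addbb //.
  by move=> y; rewrite next_prev // eqxx andbT mem_prev.
by move=> y _; rewrite next_prev.
Qed.

(** * From an odd zero-sum choice of edges to a rainbow odd cycle *)

Theorem rainbow_odd_cycle (T I : finType) (e : rel T) (F : I -> {set {set T}}) :
  symmetric e -> odd #|I| -> #|T| <= #|I|.+1 ->
  (forall i, is_odd_cycle e (F i)) ->
  exists R, is_odd_cycle e R /\ rainbow F R.
Proof.
move=> syme oddI leTI hF.
have /card_gt0P[i0 _] : 0 < #|I| by case: #|I| oddI.
have [t0 _] : exists t, t \in T.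
  by have [[[|t s] [_ szs _]] _] := hF i0 => //; exists t.
pose D := {t : T | t != t0}.
have leDI : #|{: D}| <= #|I|.
  by rewrite card_sig cardC1 -ltnS; case: #|T| leTI.
(* Taking [g] as a finite function makes the existence of a good pair decidable. *)
pose good (J : {set I}) (g : {ffun I -> {set T}}) :=
  [&& [forall j in J, g j \in F j], odd #|J|
    & [forall d : D, ~~ \xor_(j in J) (val d \in g j)]].
have [/existsP[J /existsP[g /and3P[/forall_inP gF oddJ /forallP gJ]]]|nogood] :=
    boolP [exists J, exists g, good J g]; last first.
  suff : ~~ odd #|I| by rewrite oddI.
  apply: (@no_odd_relation_even I D {set T} (fun E d => val d \in E) F leDI).
  - by move=> i; case: (hF i).
  - move=> i d; have [[s [/andP[_ us] szs ->]] _] := hF i.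
    exact: cycle_edges_degree.
  - move=> J g gF gJ; apply: contra nogood => oddJ.
    apply/existsP; exists J; apply/existsP; exists (finfun g).
    apply/and3P; split=> //.
      by apply/forall_inP => j jJ; rewrite ffunE gF.
    by apply/forallP => d; under eq_bigr do rewrite ffunE; rewrite gJ.
have edgeP j : j \in J -> exists x y, [/\ x != y, e x y & g j = [set x; y]].
  move=> /gF; have [[s [/andP[cs us] szs ->]] _] := hF j.
  case/imsetP => x xs ->; exists x, (next s x); split=> //.
    by rewrite eq_sym next_neq.
  exact: next_cycle cs xs.
pose adj := [rel x y | (x != y) && ([set x; y] \in g @: J)].
have symadj : symmetric adj by move=> x y; rewrite /= eq_sym setUC.
have adj_e x y : adj x y -> e x y.
  case/andP=> nxy /imsetP[j jJ]; have [a [b [nab eab ->]]] := edgeP _ jJ.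
  move=> /setP eqS; have := eqS x; have := eqS y; rewrite !inE !eqxx orbT /=.
  case/esym/orP=> /eqP ya; case/esym/orP=> /eqP xa; subst => //.
  - by rewrite eqxx in nxy.
  - by rewrite syme.
  - by rewrite eqxx in nxy.
have [[s cs os]|[f fP]] := odd_cycle_or_bipartite symadj; last first.
  (* The colouring is shifted to vanish at [t0], the vertex where no parity is imposed. Each edge
     has odd [h]-sum, so the total over [J] is odd, while counting by vertices gives zero. *)
  pose h x := f x (+) f t0.
  have hg j : j \in J -> \xor_(x in g j) h x.
    move=> jJ; have [x [y [nxy _ gj]]] := edgeP _ jJ.
    have /fP : adj x y by rewrite /= nxy -gj imset_f.
    rewrite gj big_setU1 ?inE //= big_set1 /h.
    by case: (f x); case: (f y); case: (f t0).
  have : \xor_(j in J) \xor_(x in g j) h x.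
    by rewrite (eq_bigr (fun=> true)) ?xor_true.
  rewrite xor_xor big1 // => x; rewrite inE => xJ.
  have [->|nx] := eqVneq x t0; first by rewrite /h addbb.
  by have := gJ (exist _ x nx); rewrite /= xJ.
have [c /andP[cc uc] oc] := odd_cycle_ucycle cs os.
(* Length 1 would be a loop, which [adj] excludes. *)
have szc : 2 < size c.
  by case: c cc oc {uc} => [|x [|y [|z c]]] //=; rewrite eqxx.
have sRg E : E \in cycle_edges c -> E \in g @: J.
  by case/imsetP => x xc ->; have /andP[] := next_cycle cc xc.
exists (cycle_edges c); split.
  split; last by rewrite card_cycle_edges.
  exists c; split=> //; apply/andP; split=> //.
  exact: sub_cycle adj_e _ cc.
(* [g] may repeat an edge on [J]: any index yielding [E] serves as its colour, and the colour
   determines [E]. *)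
have col (E : {E | E \in cycle_edges c}) :
    exists j, (j \in J) && (g j == val E).
  by have /imsetP[j jJ ->] := sRg _ (valP E); exists j; rewrite jJ eqxx.
split.
  apply/subsetP => E /sRg/imsetP[j jJ ->].
  by apply/bigcupP; exists j => //; apply: gF.
exists (fun E => xchoose (col E)); split=> [E1 E2 eqE|E].
  have /andP[_ /eqP g1] := xchooseP (col E1).
  have /andP[_ /eqP g2] := xchooseP (col E2).
  by apply: val_inj; rewrite -g1 -g2 eqE.
by have /andP[/gF gjF /eqP gE] := xchooseP (col E); move: gjF; rewrite gE.
Qed.

Theorem theorem1p2 (n : nat) (hn : 1 <= n)
    (F : 'I_(2 * uphalf n - 1) -> {set {set 'I_n}})
    (hF : forall i, is_odd_cycle (@complete_graph n) (F i)) :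
  exists R : {set {set 'I_n}},
    is_odd_cycle (@complete_graph n) R /\ rainbow F R.
Proof.
(* Positivity makes the truncated subtraction in [2 * uphalf n - 1] exact. *)
have m0 : 0 < uphalf n by case: n hn {F hF} => [|[]].
apply: rainbow_odd_cycle hF => [x y||]; rewrite ?card_ord.
- by rewrite /complete_graph /= eq_sym.
- by rewrite oddB ?muln_gt0 // oddM.
- rewrite subn1 prednK ?muln_gt0 // mul2n.
  by rewrite -{1}(odd_double_half n) uphalf_half doubleD leq_add2r; case: odd.
Qed.
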